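(* Let $\mathcal H$ be a separable Hilbert space, $(X,\mu)$ a non-atomic measure space, and $\{T_t\}_{t\in X}$ a compact operator-valued Bessel family. Define the positive operator-valued measure $\Phi(E)=\int_E T_t\,d\mu(t)$ for measurable $E\subset X$. Then the operator-norm closure of the range $\{\Phi(E):E\subset X\text{ measurable}\}$ is a convex subset of $\mathcal B(\mathcal H)$.
   Context: $\mathcal K(\mathcal H)$ denotes the set of positive compact operators on $\mathcal H$. A map $T=\{T_t\}_{t\in X}:X\to\mathcal K(\mathcal H)$ is a compact operator-valued Bessel family if (i) for all $f,g\in\mathcal H$ the function $t\mapsto\langle T_tf,g\rangle$ is measurable, and (ii) there is $B>0$ with $\int_X\langle T_tf,f\rangle\,d\mu(t)\le B\|f\|^2$ for all $f\in\mathcal H$. The integral defining $\Phi(E)$ is understood weakly: $\langle\Phi(E)f,g\rangle=\int_E\langle T_tf,g\rangle\,d\mu(t)$. *)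

(* Defs.v *)
From HB Require Import structures.
From mathcomp Require Import all_boot all_order all_algebra.
From mathcomp Require Import all_classical all_reals all_analysis.
From mathcomp Require Import complex.

Set Implicit Arguments.
Unset Strict Implicit.
Unset Printing Implicit Defensive.

Import Order.TTheory GRing.Theory Num.Theory.
Local Open Scope classical_set_scope.
Local Open Scope ring_scope.

Definition cRe {R : realType} (z : R[i]) : R := @complex.Re R z.
Definition cIm {R : realType} (z : R[i]) : R := @complex.Im R z.

Section Hilbert.
Variables (R : realType) (V : lmodType R[i]) (ip : V -> V -> R[i]).

Definition is_inner_product : Prop :=
  [/\ (forall (a : R[i]) (f g h : V), ip (a *: f + g) h = a * ip f h + ip g h),
      (forall f g : V, ip g f = conjc (ip f g)),
      (forall f : V, 0 <= ip f f) &
      (forall f : V, ip f f = 0 -> f = 0)].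

Definition hnorm (f : V) : R := Num.sqrt (cRe (ip f f)).

Definition hilbert_complete : Prop :=
  forall u : nat -> V,
    (forall e : R, 0 < e -> exists N : nat, forall m n : nat,
        (N <= m)%N -> (N <= n)%N -> hnorm (u m - u n) < e) ->
    exists l : V, forall e : R, 0 < e -> exists N : nat, forall n : nat,
        (N <= n)%N -> hnorm (u n - l) < e.

Definition hilbert_separable : Prop :=
  exists D : set V, countable D /\
    forall (f : V) (e : R), 0 < e -> exists d : V, D d /\ hnorm (f - d) < e.

Definition separable_hilbert_space : Prop :=
  [/\ is_inner_product, hilbert_complete & hilbert_separable].

Definition linear_op (A : V -> V) : Prop :=
  forall (a : R[i]) (f g : V), A (a *: f + g) = a *: A f + A g.

Definition bounded_op (A : V -> V) : Prop :=
  linear_op A /\ exists M : R, forall f : V, hnorm (A f) <= M * hnorm f.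

(* compact operator: bounded, and maps the closed unit ball to a
   relatively compact set (sequential form: every bounded sequence has a
   subsequence whose image converges in norm). *)
Definition compact_op (A : V -> V) : Prop :=
  bounded_op A /\
  forall u : nat -> V, (forall n, hnorm (u n) <= 1) ->
    exists (phi : nat -> nat) (l : V),
      (forall n, (phi n < phi n.+1)%N) /\
      forall e : R, 0 < e -> exists N : nat, forall n : nat,
        (N <= n)%N -> hnorm (A (u (phi n)) - l) < e.

Definition positive_op (A : V -> V) : Prop :=
  forall f : V, 0 <= ip (A f) f.

Definition positive_compact_op (A : V -> V) : Prop :=
  positive_op A /\ compact_op A.

Definition opdist_le (P Q : V -> V) (e : R) : Prop :=
  forall f : V, hnorm (P f - Q f) <= e * hnorm f.

Definition op_closure (S : set (V -> V)) : set (V -> V) :=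
  [set P | bounded_op P /\
     forall e : R, 0 < e -> exists Q, S Q /\ opdist_le P Q e].

Definition op_convex (S : set (V -> V)) : Prop :=
  (forall P, S P -> bounded_op P) /\
  forall P Q, S P -> S Q -> forall l : R, 0 <= l <= 1 ->
    S (fun f => (l%:C)%C *: P f + ((1 - l)%:C)%C *: Q f).

End Hilbert.

Section Measure.
Variables (d : measure_display) (X : measurableType d) (R : realType).
Variable (mu : {measure set X -> \bar R}).

Definition is_atom (A : set X) : Prop :=
  [/\ measurable A, (0 < mu A)%E &
      forall B, measurable B -> B `<=` A -> mu B = 0%E \/ mu (A `\` B) = 0%E].

Definition non_atomic : Prop := forall A, ~ is_atom A.

Definition cintegral (E : set X) (h : X -> R[i]) : R[i] :=
  (Rintegral mu E (fun t => cRe (h t)) +i* Rintegral mu E (fun t => cIm (h t)))%C.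

Variables (V : lmodType R[i]) (ip : V -> V -> R[i]).

Definition bessel_family (T : X -> V -> V) : Prop :=
  [/\ (forall t, positive_compact_op ip (T t)),
      (forall f g : V,
          measurable_fun setT (fun t => cRe (ip (T t f) g)) /\
          measurable_fun setT (fun t => cIm (ip (T t f) g))) &
      exists B : R, 0 < B /\ forall f : V,
        (\int[mu]_t (cRe (ip (T t f) f))%:E <= (B * hnorm ip f ^+ 2)%:E)%E].

(* P = Phi(E) = \int_E T_t dmu(t), understood weakly *)
Definition is_Phi (T : X -> V -> V) (E : set X) (P : V -> V) : Prop :=
  forall f g : V, ip (P f) g = cintegral E (fun t => ip (T t f) g).

Definition Phi_range (T : X -> V -> V) : set (V -> V) :=
  [set P | exists E, measurable E /\ is_Phi T E P].

End Measure.

(* Main.v *)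
(* Two ideas give the theorem. First, the positive compact operators are
   norm-separable, so for every r > 0 the space X splits into countably many
   measurable pieces on which t |-> T_t is within r of a constant operator.
   All the operators being self-adjoint, norms can be read off the quadratic
   forms <T_t f, f>, which are nonnegative measurable functions of t.
   Second, on a piece A of finite measure, Sierpinski's theorem gives B in A
   with mu B = l mu (A n E1) + (1 - l) mu (A n E2), so that Phi(B) and
   l Phi(A n E1) + (1 - l) Phi(A n E2) differ by at most 2 r mu A in norm. The
   measure need not be sigma-finite, but the T_t vanish off a countable union
   of sets of finite measure (Markov's inequality along a dense sequence), and
   choosing r small enough on each of these sets makes the total error as small
   as desired. *)

Require Import Defs.
From HB Require Import structures.
From mathcomp Require Import all_boot all_order all_algebra.
From mathcomp Require Import all_classical all_reals all_analysis.
From mathcomp Require Import measurable_realfun complex.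
From mathcomp Require Import ring lra.
Import Order.TTheory GRing.Theory Num.Theory.
Set Implicit Arguments.
Unset Strict Implicit.
Unset Printing Implicit Defensive.
Local Open Scope classical_set_scope.
Local Open Scope ring_scope.

(** * Positive semidefinite forms *)

Section PsdForms.
Variables (R : realType) (W : lmodType R).
Implicit Types (b : W -> W -> R) (f g h : W).

(** Definiteness is left out so that the forms [b (A f) g] of positive operators, and their
    integrals over sets, are instances too. *)
Definition psd_form b : Prop :=
  [/\ forall a f g h, b (a *: f + g) h = a * b f h + b g h,
      forall f g, b f g = b g f &
      forall f, 0 <= b f f].

Section OneForm.
Variables (b : W -> W -> R) (pb : psd_form b).

Lemma formC f g : b f g = b g f. Proof. by case: pb. Qed.

Lemma form_ge0 f : 0 <= b f f. Proof. by case: pb. Qed.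

Lemma formDl f g h : b (f + g) h = b f h + b g h.
Proof. by case: pb => lin _ _; rewrite -[f]scale1r lin mul1r scale1r. Qed.

Lemma form0l h : b 0 h = 0.
Proof. by apply: (@addrI _ (b 0 h)); rewrite -formDl !addr0. Qed.

Lemma formZl a f h : b (a *: f) h = a * b f h.
Proof. by case: pb => lin _ _; rewrite -[a *: f]addr0 lin form0l addr0. Qed.

Lemma formNl f h : b (- f) h = - b f h.
Proof. by rewrite -scaleN1r formZl mulN1r. Qed.

Lemma formBl f g h : b (f - g) h = b f h - b g h.
Proof. by rewrite formDl formNl. Qed.

Lemma formDr f g h : b h (f + g) = b h f + b h g.
Proof. by rewrite formC formDl !(formC h). Qed.

Lemma formZr a f h : b h (a *: f) = a * b h f.
Proof. by rewrite formC formZl formC. Qed.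

Lemma formNr f h : b h (- f) = - b h f.
Proof. by rewrite formC formNl formC. Qed.

Definition formE :=
  (formDl, formDr, formNl, formNr, formZl, formZr).

Lemma form_Cauchy_Schwarz f g : b f g ^+ 2 <= b f f * b g g.
Proof.
have expand a : 0 <= a ^+ 2 * b f f + 2 * a * b f g + b g g.
  by have := form_ge0 (a *: f + g); rewrite !formE (formC g f); lra.
have [bf0|bf0] := eqVneq (b f f) 0.
  rewrite bf0 mul0r; have [->|bfg0] := eqVneq (b f g) 0; first by rewrite expr0n.
  (* When [b f f = 0] the quadratic is affine in [a], and this [a] gives it the value -1. *)
  have := expand (- (b g g + 1) / (2 * b f g)); rewrite bf0 mulr0 add0r.
  have -> : 2 * (- (b g g + 1) / (2 * b f g)) * b f g = - (b g g + 1) by field.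
  by lra.
have bf_gt0 : 0 < b f f by rewrite lt_neqAle eq_sym bf0 form_ge0.
(* The minimiser of the quadratic in [a]. *)
have := expand (- b f g / b f f).
have -> : (- b f g / b f f) ^+ 2 * b f f + 2 * (- b f g / b f f) * b f g + b g g
  = (b f f * b g g - b f g ^+ 2) / b f f by field.
by rewrite pmulr_lge0 ?invr_gt0// subr_ge0.
Qed.

Definition fnorm f : R := Num.sqrt (b f f).

Lemma fnorm_ge0 f : 0 <= fnorm f. Proof. exact: sqrtr_ge0. Qed.

Lemma sqr_fnorm f : fnorm f ^+ 2 = b f f.
Proof. by rewrite sqr_sqrtr// form_ge0. Qed.

Lemma fnormP f r : 0 <= r -> (fnorm f <= r) = (b f f <= r ^+ 2).
Proof. by move=> r0; rewrite -sqr_fnorm ler_sqr// nnegrE fnorm_ge0. Qed.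

Lemma form_le f g : `|b f g| <= fnorm f * fnorm g.
Proof.
rewrite -(@ler_pXn2r _ 2)// ?nnegrE ?mulr_ge0 ?fnorm_ge0//.
by rewrite real_normK ?num_real// exprMn !sqr_fnorm form_Cauchy_Schwarz.
Qed.

Lemma fnorm0 : fnorm 0 = 0. Proof. by rewrite /fnorm form0l sqrtr0. Qed.

Lemma fnormZ a f : fnorm (a *: f) = `|a| * fnorm f.
Proof. by rewrite /fnorm !formE mulrA -expr2 sqrtrM ?sqr_ge0// sqrtr_sqr. Qed.

Lemma fnormN f : fnorm (- f) = fnorm f.
Proof. by rewrite -scaleN1r fnormZ normrN1 mul1r. Qed.

Lemma fnormD f g : fnorm (f + g) <= fnorm f + fnorm g.
Proof.
rewrite fnormP ?addr_ge0 ?fnorm_ge0// !formE (formC g f).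
have := le_trans (ler_norm _) (form_le f g).
by have := sqr_fnorm f; have := sqr_fnorm g; nra.
Qed.

Lemma fnormB f g : fnorm (f - g) <= fnorm f + fnorm g.
Proof. by rewrite -(fnormN g) fnormD. Qed.

End OneForm.
End PsdForms.

(** * Riesz representation for a complete form *)

Section Riesz.
Variables (R : realType) (W : lmodType R) (b : W -> W -> R).
Hypothesis pb : psd_form b.

Definition form_complete : Prop :=
  forall u : nat -> W,
    (forall e : R, 0 < e -> exists N : nat, forall m n : nat,
        (N <= m)%N -> (N <= n)%N -> fnorm b (u m - u n) < e) ->
    exists l : W, forall e : R, 0 < e -> exists N : nat, forall n : nat,
        (N <= n)%N -> fnorm b (u n - l) < e.

Let invS_small (e : R) : 0 < e ->
  exists N : nat, forall n : nat, (N <= n)%N -> n.+1%:R^-1 < e.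
Proof.
move=> /ltr_add_invr[N]; rewrite add0r => Ne; exists N => n Nn.
by apply: le_lt_trans Ne; rewrite lef_pV2 ?posrE ?ltr0n// ler_nat ltnS.
Qed.

(* Minimise J g = b g g - 2 phi g: minimising sequences are Cauchy by the
   parallelogram law, and the first variation of J vanishes at the limit. *)
Lemma Riesz_representation (phi : W -> R) (C : R) : form_complete ->
  (forall a f g, phi (a *: f + g) = a * phi f + phi g) ->
  (forall g, `|phi g| <= C * fnorm b g) ->
  exists v, forall g, b v g = phi g.
Proof.
move=> cplt lin bnd.
have phiD f g : phi (f + g) = phi f + phi g.
  by have := lin 1 f g; rewrite scale1r mul1r.
have phi0 : phi 0 = 0 by have := phiD 0 0; rewrite addr0; lra.
have phiZ a f : phi (a *: f) = a * phi f.
  by have := lin a f 0; rewrite !addr0 phi0 addr0.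
pose J g := b g g - 2 * phi g.
have Jlb g : - C ^+ 2 <= J g.
  rewrite /J -(sqr_fnorm pb).
  by have := le_trans (ler_norm _) (bnd g); have := sqr_ge0 (fnorm b g - C); nra.
pose m := inf (range J).
have infJ : has_inf (range J).
  by split; [exists (J 0), 0 | exists (- C ^+ 2) => _ [g _ <-]].
have mJ g : m <= J g by apply: ge_inf; [case: infJ | exists g].
have /choice[u uJ] : forall n : nat, exists g, J g < m + n.+1%:R^-1.
  move=> n; have [] := @inf_adherent _ (range J) n.+1%:R^-1 _ infJ.
    by rewrite invr_gt0.
  by move=> _ [g _ <-] Jg; exists g.
have uB k n : b (u k - u n) (u k - u n) <= 2 * (k.+1%:R^-1 + n.+1%:R^-1).
  have := mJ (2^-1 *: (u k + u n)); have := uJ k; have := uJ n.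
  rewrite /J !(formE pb) phiZ phiD (formC pb (u n) (u k)).
  by move: (k.+1%:R^-1) (n.+1%:R^-1) => r s; lra.
have [] := cplt u.
  move=> e e0; have [|N NP] := @invS_small (e ^+ 2 / 8).
    by rewrite divr_gt0// exprn_gt0.
  exists N => k n /NP kN /NP nN.
  rewrite -(@ltr_pXn2r _ 2) ?nnegrE ?fnorm_ge0//; last exact: ltW.
  rewrite sqr_fnorm//; apply: le_lt_trans (uB k n) _.
  move: kN nN (exprn_gt0 2 e0); move: (k.+1%:R^-1) (n.+1%:R^-1) => r s; lra.
move=> v vP; exists v => h.
have uh n : (b (u n) h - phi h) ^+ 2 <= (b h h + 1) * n.+1%:R^-1.
  set D := b (u n) h - phi h; set H := b h h.
  have H0 : 0 <= H by exact: form_ge0.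
  (* Nearly the optimal step along [h]; dividing by [H + 1] instead of [H] covers vectors [h] of
     norm zero. *)
  have := mJ (u n + (- D / (H + 1)) *: h); have := uJ n.
  rewrite /J !(formE pb) phiD phiZ (formC pb h (u n)) -/H => u1 u2.
  have : 2 * (- D / (H + 1)) * D + (- D / (H + 1)) ^+ 2 * H + n.+1%:R^-1 >= 0.
    move: u1 u2; move: (n.+1%:R^-1) (- D / (H + 1)) => r s; rewrite /D; lra.
  have -> : 2 * (- D / (H + 1)) * D + (- D / (H + 1)) ^+ 2 * H =
    - (D ^+ 2 / (H + 1)) - D ^+ 2 / (H + 1) ^+ 2 by field; lra.
  have : 0 <= D ^+ 2 / (H + 1) ^+ 2 by rewrite divr_ge0 ?sqr_ge0.
  move=> D1 D2; rewrite mulrC -ler_pdivrMr; last lra.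
  by move: D1 D2; move: (n.+1%:R^-1) => r; lra.
apply/eqP; rewrite -subr_eq0 -sqrf_eq0 eq_le sqr_ge0 andbT.
apply/ler_addgt0Pl => e e0; rewrite addr0.
set H := b h h; have H0 : 0 <= H by exact: form_ge0.
(* The final error is at most [2 * (H + 1) * e'] from [uh] plus [2 * H * e'] from Cauchy-Schwarz,
   hence at most [e]. *)
pose e' := e / (4 * (H + 1)).
have e'0 : 0 < e' by rewrite divr_gt0// mulr_gt0//; lra.
have e'E : 4 * (H + 1) * e' = e by rewrite /e'; field; lra.
have [N NP] := invS_small e'0.
have [|N' N'P] := vP (Num.sqrt e'); first by rewrite sqrtr_gt0.
pose n := maxn N N'.
have := NP n (leq_maxl _ _); have := N'P n (leq_maxr _ _) => un vn.
have {}un : b (u n - v) (u n - v) <= e'.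
  rewrite -(sqr_fnorm pb) -[leRHS]sqr_sqrtr; last exact: ltW.
  by rewrite ler_sqr ?nnegrE ?sqrtr_ge0 ?fnorm_ge0// ltW.
have wh := form_Cauchy_Schwarz pb (u n - v) h.
have := uh n; rewrite -/H in wh *.
have -> : b v h = b (u n) h - b (u n - v) h by rewrite formBl// opprB addrC subrK.
set p := b (u n) h; set q := b (u n - v) h in wh *; set r := n.+1%:R^-1 in vn *.
move=> pr; have : (p - q - phi h) ^+ 2 <= 2 * (p - phi h) ^+ 2 + 2 * q ^+ 2.
  by have := sqr_ge0 (p - phi h + q); nra.
by move=> /le_trans; apply; nra.
Qed.

End Riesz.

(** * Norm separability of positive compact operators *)

Section CompactSeparable.
Variables (R : realType) (W : lmodType R) (b : W -> W -> R).
Hypothesis pb : psd_form b.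

Local Notation nrm := (fnorm b).
Local Notation Q A f := (b (A f) f).

(** Over the reals positivity does not imply self-adjointness, so symmetry is built in through
    [psd_form]. *)
Definition psd_compact (A : W -> W) : Prop :=
  [/\ forall a f g, A (a *: f + g) = a *: A f + A g,
      psd_form (fun f g => b (A f) g),
      exists M, forall f, nrm (A f) <= M * nrm f &
      forall u : nat -> W, (forall n, nrm (u n) <= 1) ->
        exists (phi : nat -> nat) (l : W),
          (forall n, (phi n < phi n.+1)%N) /\
          forall e : R, 0 < e -> exists N : nat, forall n : nat,
            (N <= n)%N -> nrm (A (u (phi n)) - l) < e].

Lemma psd_compact0 : psd_compact (fun=> 0).
Proof.
split=> [a f g|||u _].
- by rewrite scaler0 addr0.
- by split=> [a f g h|f g|f]; rewrite !form0l// mulr0 addr0.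
- by exists 0 => f; rewrite fnorm0// mul0r.
- by exists id, 0; split=> // e e0; exists 0%N => n _; rewrite subr0 fnorm0.
Qed.

Lemma psd_compactB A f g : psd_compact A -> A (f - g) = A f - A g.
Proof.
by case=> lin _ _ _; rewrite addrC -scaleN1r lin scaleN1r addrC.
Qed.

Lemma psd_compactD A f g : psd_compact A -> A (f + g) = A f + A g.
Proof. by case=> lin _ _ _; have := lin 1 f g; rewrite !scale1r. Qed.

(** Without a finite net, a greedy choice yields a sequence in the unit ball whose images are
    pairwise more than [e] apart, so that no subsequence of them converges. *)
Lemma psd_compact_net A e : psd_compact A -> 0 < e ->
  exists s : seq W, (forall x, x \in s -> nrm x <= 1) /\
    forall f, nrm f <= 1 -> exists2 x, x \in s & nrm (A f - A x) <= e.
Proof.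
move=> [_ _ _ cpt] e0; apply: contrapT => no_net.
have /choice[g gP] : forall s : seq W, exists f,
    (forall x, x \in s -> nrm x <= 1) ->
    nrm f <= 1 /\ forall x, x \in s -> e < nrm (A f - A x).
  move=> s; apply: contrapT => no_f; apply: no_net; exists s; split.
    by apply: contrapT => ns; apply: no_f; exists 0 => /ns.
  move=> f f1; apply: contrapT => nx; apply: no_f; exists f => _; split=> // x xs.
  by rewrite ltNge; apply/negP => fx; apply: nx; exists x.
(* [L n] lists the first [n] chosen points, the latest one first. *)
pose L n := iter n (fun s => g s :: s) [::].
have L1 n x : x \in L n -> nrm x <= 1.
  elim: n x => // n IH x; rewrite in_cons => /orP[/eqP->|/IH//].
  by have [] := gP _ IH.
pose u n := g (L n).
have uL m n : (m < n)%N -> u m \in L n.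
  elim: n => // n IH; rewrite ltnS leq_eqVlt in_cons.
  by case/orP=> [/eqP->|/IH->]; rewrite ?eqxx ?orbT.
have [|phi [l [incr cvg]]] := cpt u.
  by move=> n; have [] := gP _ (@L1 n).
have [|N NP] := cvg (e / 2); first by rewrite divr_gt0.
have := (gP _ (@L1 (phi N.+1))).2 _ (uL _ _ (incr N)).
apply/negP; rewrite -leNgt -/(u _).
have := fnormB pb (A (u (phi N.+1)) - l) (A (u (phi N)) - l).
rewrite opprB addrA subrK => /le_trans; apply.
by have := NP N (leqnn _); have := NP N.+1 (leqnSn _); lra.
Qed.

(** Cauchy-Schwarz for the form of [A] at [h] and [A h] bounds the fourth power of [nrm (A h)] by
    [Q A h * (M * nrm (A h) ^+ 2)]; then divide. *)
Lemma psd_sqr_norm_le A M h : psd_form (fun f g => b (A f) g) ->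
  (forall f, nrm (A f) <= M * nrm f) -> 0 <= M ->
  nrm (A h) ^+ 2 <= M * Q A h.
Proof.
move=> pA bnd M0; have := form_Cauchy_Schwarz pA h (A h).
have := le_trans (ler_norm _) (form_le pb (A (A h)) (A h)).
have := bnd (A h); have := form_ge0 pA h; rewrite -!(sqr_fnorm pb (A h)).
set n := nrm (A h); have n0 : 0 <= n by exact: fnorm_ge0.
have [n00|n1] := eqVneq n 0; first by rewrite n00 expr0n /= => *; rewrite mulr_ge0.
have {}n0 : 0 < n by rewrite lt_neqAle eq_sym n1.
set q := Q A h; set r := b (A (A h)) (A h); set k := nrm (A (A h)).
move=> q0 kn rk nr.
have rn : r <= M * n ^+ 2 by nra.
have : n ^+ 2 * n ^+ 2 <= M * q * n ^+ 2 by rewrite -expr2; nra.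
by rewrite ler_pM2r// exprn_gt0.
Qed.

Variables (D : nat -> W).
Hypothesis Ddense : forall f e, 0 < e -> exists n, nrm (f - D n) < e.

(* A pair (i, j) in l encodes a point D i of a net for A on the unit ball,
   together with an approximation D j of A (D i). Two positive compact
   operators with a common code are close, and there are countably many codes. *)
Definition net_code (A : W -> W) (M : nat) (l : seq (nat * nat)) (e : R) : Prop :=
  [/\ forall f, nrm (A f) <= M%:R * nrm f,
      forall p, p \in l -> nrm (D p.1) <= 2 /\ nrm (A (D p.1) - D p.2) <= e &
      forall f, nrm f <= 1 -> exists2 p, p \in l & nrm (A (f - D p.1)) <= 2 * e].

(** The bound [M] is fixed before [e], so that the precision may later be chosen as a function of
    [M]. *)
Lemma net_code_exists A : psd_compact A ->
  exists M : nat, forall e, 0 < e -> exists l, net_code A M l e.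
Proof.
move=> pA; have [lin psd [M0 bnd0] _] := pA.
pose M := (Num.truncn M0).+1.
have bnd f : nrm (A f) <= M%:R * nrm f.
  apply: le_trans (bnd0 f) _; rewrite ler_wpM2r ?fnorm_ge0//.
  by apply: ltW; exact: truncnS_gt.
exists M => e e0.
have [s [s1 sP]] := psd_compact_net pA e0.
have /choice[c cP] : forall x : W, exists p : nat * nat,
    [/\ nrm (x - D p.1) < 1, nrm (x - D p.1) < e / M%:R & nrm (A (D p.1) - D p.2) < e].
  (* Distance below 1 keeps [D i] in the ball of radius 2; distance below [e / M] means that [A]
     separates the two points by at most [e]. *)
  move=> x; have [|i iP] := Ddense x (e := Num.min 1 (e / M%:R)).
    by rewrite lt_min ltr01 divr_gt0.
  have [j jP] := Ddense (A (D i)) e0.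
  by exists (i, j); move: iP; rewrite lt_min => /andP[].
exists (map c s); split=> // [p /mapP[x xs ->]|f /sP[x xs fx]].
  have [x1 _ x2] := cP x; split; last exact: ltW.
  have := fnormB pb x (x - D (c x).1); rewrite opprB addrC subrK => /le_trans; apply.
  by have := s1 x xs; lra.
exists (c x); first exact: map_f.
have [_ xe _] := cP x.
have -> : A (f - D (c x).1) = (A f - A x) + A (x - D (c x).1).
  by rewrite !(psd_compactB _ _ pA) addrA subrK.
apply: le_trans (fnormD pb _ _) _.
rewrite mulr_natl mulr2n lerD//; apply: le_trans (bnd _) _.
by rewrite mulrC -ler_pdivlMr ?ltr0n// ltW.
Qed.

(** The net points [x] for [A] and [y] for [B] may differ, but [A] and [B] almost agree at both, the
    approximate values being shared. What remains is to bound [B] at [f - x], and this is where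
    positivity enters. *)
Lemma net_code_close A B M l e f : psd_compact A -> psd_compact B -> 0 <= e ->
  net_code A M l e -> net_code B M l e -> nrm f <= 1 ->
  nrm (A f - B f) <= 12 * e + Num.sqrt (30 * M%:R * e).
Proof.
move=> pA pB e0 [bA lA nA] [bB lB nB] f1.
have [p pl pP] := nA f f1; have [p' p'l p'P] := nB f f1.
have [p2 pA'] := lA p pl; have [_ pB'] := lB p pl.
have [p2' p'A] := lA p' p'l; have [_ p'B] := lB p' p'l.
set x := D p.1 in pP p2 pA' pB'; set y := D p'.1 in p'P p2' p'A p'B.
have ABx : nrm (A x - B x) <= 2 * e.
  have := fnormB pb (A x - D p.2) (B x - D p.2); rewrite opprB addrA subrK; lra.
have ABy : nrm (A y - B y) <= 2 * e.
  have := fnormB pb (A y - D p'.2) (B y - D p'.2); rewrite opprB addrA subrK; lra.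
set g := f - x in pP; set h := f - y in p'P.
have g3 : nrm g <= 3 by have := fnormB pb f x; rewrite -/g; lra.
have h3 : nrm h <= 3 by have := fnormB pb f y; rewrite -/h; lra.
(* A h + B g = (A - B) (x - y) + A g + B h is small, hence so is
   b (A h) h = b (A h + B g) h - b g (B h). *)
have AhBg : nrm (A h + B g) <= 8 * e.
  have -> : A h + B g = (A g + B h) + ((A x - B x) - (A y - B y)).
    have -> : A h = A g + (A x - A y).
      by rewrite -psd_compactB// -psd_compactD// /g /h addrA subrK.
    have -> : B g = B h + (B y - B x).
      by rewrite -psd_compactB// -psd_compactD// /g /h addrA subrK.
    rewrite addrACA; congr (_ + _).
    by rewrite [B y - _]addrC addrACA opprB [- A y + _]addrC.
  have := fnormD pb (A g + B h) ((A x - B x) - (A y - B y)).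
  have := fnormD pb (A g) (B h); have := fnormB pb (A x - B x) (A y - B y).
  by lra.
have [_ psdA _ _] := pA; have [_ psdB _ _] := pB.
(* As [g] and [h] have norm at most 3, the constant is 3 * 8 + 3 * 2. *)
have Ahh : Q A h <= 30 * e.
  have -> : Q A h = b (A h + B g) h - b g (B h).
    by rewrite formDl// (formC pb g) -(formC psdB g) addrK.
  have := le_trans (ler_norm _) (form_le pb (A h + B g) h).
  have := le_trans (ler_norm _) (form_le pb (- g) (B h)).
  rewrite formNl// fnormN//.
  have := fnorm_ge0 b (A h + B g); have := fnorm_ge0 b g; have := fnorm_ge0 b h.
  have := fnorm_ge0 b (B h); nra.
have Ah : nrm (A h) <= Num.sqrt (30 * M%:R * e).
  rewrite -(ger0_norm (fnorm_ge0 b (A h))) -sqrtr_sqr ler_wsqrtr//.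
  apply: le_trans (psd_sqr_norm_le _ psdA bA _) _ => //.
  by rewrite (mulrC 30) -mulrA ler_wpM2l.
have Bg : nrm (B g) <= 8 * e + Num.sqrt (30 * M%:R * e).
  have -> : B g = (A h + B g) - A h by rewrite addrC addKr.
  by apply: le_trans (fnormB pb _ _) _; rewrite lerD.
have -> : A f - B f = (A g + (A x - B x)) - B g.
  by rewrite /g (psd_compactB _ _ pA) (psd_compactB _ _ pB) addrA subrK opprB addrA subrK.
have := fnormB pb (A g + (A x - B x)) (B g); have := fnormD pb (A g) (A x - B x).
by lra.
Qed.

Lemma quadratic_dist_le A B e : psd_compact A -> psd_compact B ->
  (forall f, nrm f <= 1 -> nrm (A f - B f) <= e) ->
  forall f, `|Q A f - Q B f| <= e * b f f.
Proof.
move=> [linA _ _ _] [linB _ _ _] le1 f.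
rewrite -formBl//; apply: le_trans (form_le pb _ _) _.
rewrite -sqr_fnorm// expr2 mulrA.
have [->|n0] := eqVneq (nrm f) 0; first by rewrite !mulr0.
rewrite ler_wpM2r ?fnorm_ge0//.
have n_gt0 : 0 < nrm f by rewrite lt_neqAle eq_sym n0 fnorm_ge0.
have scale (C : W -> W) : (forall a f g, C (a *: f + g) = a *: C f + C g) ->
    C ((nrm f)^-1 *: f) = (nrm f)^-1 *: C f.
  move=> linC; have C0 : C 0 = 0.
    have := linC (-1) 0 0; rewrite scaler0 addr0; by rewrite scaleN1r addNr.
  by have := linC (nrm f)^-1 f 0; rewrite C0 !addr0.
have := le1 ((nrm f)^-1 *: f).
rewrite fnormZ// ger0_norm ?invr_ge0 ?fnorm_ge0// mulVf// => /(_ (lexx _)).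
rewrite !scale// -scalerBr fnormZ// ger0_norm ?invr_ge0 ?fnorm_ge0//.
by rewrite ler_pdivrMl// mulrC.
Qed.

(** One operator is kept for each code that occurs; any other operator with that code is close to
    it, and codes are countable through [pickle]. *)
Lemma psd_compact_separable (e : R) : 0 < e ->
  exists S : nat -> W -> W, (forall k, psd_compact (S k)) /\
    forall A, psd_compact A -> exists k, forall f, `|Q A f - Q (S k) f| <= e * b f f.
Proof.
(* The two terms of the minimum make both summands in [net_code_close] at most [e / 2]; [M.+1] keeps
   the denominator positive. *)
move=> e0; pose eps (M : nat) := Num.min (e / 24) (e ^+ 2 / (120 * M.+1%:R)).
have eps0 M : 0 < eps M by rewrite lt_min !divr_gt0 ?exprn_gt0 ?mulr_gt0.
have epsP M : 12 * eps M + Num.sqrt (30 * M%:R * eps M) <= e.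
  have h1 : eps M <= e / 24 by rewrite /eps ge_min lexx.
  have h2 : Num.sqrt (30 * M%:R * eps M) <= e / 2.
    rewrite -[e / 2]ger0_norm -?sqrtr_sqr ?ler_wsqrtr ?divr_ge0 ?ltW//.
    have : eps M <= e ^+ 2 / (120 * M.+1%:R) by rewrite /eps ge_min lexx orbT.
    rewrite ler_pdivlMr ?mulr_gt0// -natr1.
    by have := eps0 M; have : 0 <= M%:R :> R by []; nra.
  by lra.
pose code : Type := (nat * seq (nat * nat))%type.
have /choice[S SP] : forall k : nat, exists A, psd_compact A /\
     forall (c : code) B, pickle c = k -> psd_compact B ->
      net_code B c.1 c.2 (eps c.1) -> net_code A c.1 c.2 (eps c.1).
  move=> k; case: (pselect (exists A (c : code), [/\ pickle c = k, psd_compact A &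
      net_code A c.1 c.2 (eps c.1)])) => [[A [c [ck pA cA]]]|no].
    exists A; split=> // c' B; rewrite -ck => /(pcan_inj pickleK) -> _ _.
    exact: cA.
  (* Default for integers that encode no operator. *)
  exists (fun=> 0); split; first exact: psd_compact0.
  by move=> c B ck pB cB; exfalso; apply: no; exists B, c.
exists S; split=> [k|A pA]; first by have [] := SP k.
have [M /(_ _ (eps0 M))[l cA]] := net_code_exists pA.
exists (pickle ((M, l) : code)).
have [pS /(_ _ _ erefl pA cA) cS] := SP (pickle ((M, l) : code)).
apply: quadratic_dist_le => // f f1.
by apply: le_trans (net_code_close pA pS (ltW (eps0 M)) cA cS f1) (epsP M).
Qed.

(** Quadratic forms of bounded operators are continuous. Closeness can thus be tested at countably
    many vectors, which makes the set of [t] with [T t] close to a given operator measurable. *)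
Lemma quadratic_dist_dense A B e : psd_compact A -> psd_compact B -> 0 <= e ->
  (forall n, `|Q A (D n) - Q B (D n)| <= e * b (D n) (D n)) ->
  forall f, `|Q A f - Q B f| <= e * b f f.
Proof.
move=> pA pB e0 onD f.
have [_ psdA [MA bA] _] := pA; have [_ psdB [MB bB] _] := pB.
pose M := `|MA| + `|MB|; pose c g h := b (A g) h - b (B g) h.
have M0 : 0 <= M by rewrite addr_ge0.
have cM g h : `|c g h| <= M * (nrm g * nrm h).
  rewrite /c -formBl//; apply: le_trans (form_le pb _ _) _.
  rewrite mulrA ler_wpM2r ?fnorm_ge0//; apply: le_trans (fnormB pb _ _) _.
  rewrite mulrDl lerD//.
    by apply: le_trans (bA g) _; rewrite ler_wpM2r ?fnorm_ge0// ler_norm.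
  by apply: le_trans (bB g) _; rewrite ler_wpM2r ?fnorm_ge0// ler_norm.
apply/ler_addgt0Pr => r r0.
set N := nrm f; have N0 : 0 <= N by exact: fnorm_ge0.
(* Replacing [f] by a point at distance [x <= 1] costs at most [x * K]. *)
pose K := e * (2 * N + 1) + 2 * M * (N + 1) + M.
have K0 : 0 <= K by rewrite /K; nra.
have [|n] := Ddense f (e := Num.min 1 (r / (K + 1))).
  by rewrite lt_min ltr01 divr_gt0//; lra.
rewrite lt_min ltr_pdivlMr; last lra.
set d := D n; set w := f - d; case/andP => w1 wr.
have wN0 : 0 <= nrm w by exact: fnorm_ge0.
have dN : nrm d <= N + nrm w by have := fnormB pb f w; rewrite opprB addrC subrK.
have dN0 : 0 <= nrm d by exact: fnorm_ge0.
have -> : Q A f - Q B f = c d d + 2 * c d w + c w w.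
  have -> : f = d + w by rewrite addrC subrK.
  move: w {w1 wr wN0 dN} => w.
  rewrite /c (psd_compactD _ _ pA) (psd_compactD _ _ pB) !(formDl pb) !(formDr pb).
  by have /= -> := formC psdA w d; have /= -> := formC psdB w d; ring.
have := onD n; rewrite -/d -/(c d d) -!(sqr_fnorm pb) -/N => cd.
have := cM d w; have := cM w w; move: (c d w) (c w w) (c d d) cd => cdw cww cdd.
move: (nrm d) (nrm w) dN0 dN wN0 w1 wr => y x y0 yx x0 x1 xr cd cww' cdw'.
apply: (@le_trans _ _ (e * y ^+ 2 + 2 * (M * (y * x)) + M * (x * x))).
  apply: le_trans (ler_normD _ _) _; rewrite lerD//.
  apply: le_trans (ler_normD _ _) _; rewrite lerD//.
  by rewrite normrM ger0_norm// ler_wpM2l.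
have y2 : y ^+ 2 <= N ^+ 2 + x * (2 * N + 1) by nra.
have yx' : y * x <= x * (N + 1) by nra.
have xx : x * x <= x by nra.
have := ler_wpM2l e0 y2; have := ler_wpM2l M0 yx'; have := ler_wpM2l M0 xx.
by have : x * K <= r by [nra]; rewrite /K; nra.
Qed.

End CompactSeparable.

(** * Non-atomic measures *)

Section Sierpinski.
Context (d : measure_display) (X : measurableType d) (R : realType).
Context (mu : {measure set X -> \bar R}).
Hypothesis na : non_atomic mu.
Variable A : set X.
Hypotheses (mA : measurable A) (Afin : (mu A < +oo)%E).

Let m (S : set X) : R := fine (mu S).

Let mE S : measurable S -> S `<=` A -> mu S = (m S)%:E.
Proof.
move=> mS SA; rewrite fineK// ge0_fin_numE//.
by apply: le_lt_trans Afin; apply: le_measure; rewrite ?inE.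
Qed.

Let mD S S' : measurable S -> measurable S' -> S `<=` A -> S' `<=` A `\` S ->
  m (S `|` S') = m S + m S'.
Proof.
move=> mS mS' SA S'A; have S'A' : S' `<=` A by move=> x /S'A[].
have fS : mu S \is a fin_num by rewrite mE.
have fS' : mu S' \is a fin_num by rewrite mE.
rewrite /m measureU ?fineD//.
by rewrite -subset0 => x [Sx /S'A[]].
Qed.

Let m_ge0 S : 0 <= m S. Proof. by rewrite fine_ge0. Qed.

Let mS_le S S' : measurable S -> measurable S' -> S `<=` S' -> S' `<=` A -> m S <= m S'.
Proof.
move=> mS mS' SS' S'A; have SA := subset_trans SS' S'A.
by rewrite -lee_fin -!mE//; apply: le_measure; rewrite ?inE.
Qed.

(** A set of positive measure that is no atom splits into two parts of positive measure, one of
    which has at most half the measure; iterate. *)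
Lemma non_atomic_small (S : set X) (e : R) : measurable S -> S `<=` A ->
  (0 < mu S)%E -> 0 < e ->
  exists C, [/\ measurable C, C `<=` S, (0 < mu C)%E & (mu C <= e%:E)%E].
Proof.
move=> mS SA S0 e0.
have half (B : set X) : measurable B -> B `<=` A -> 0 < m B ->
    exists C, [/\ measurable C, C `<=` B, 0 < m C & m C <= m B / 2].
  move=> mB BA B0; have : ~ is_atom mu B by exact: na.
  move=> natom; have : exists C, [/\ measurable C, C `<=` B, mu C <> 0%E &
      mu (B `\` C) <> 0%E].
    apply: contrapT => no; apply: natom; split; rewrite ?mE ?lte_fin// => C mC CB.
    apply: contrapT => /not_orP[C0 BC0]; apply: no; by exists C.
  move=> [C [mC CB C0 BC0]].
  have mBC : measurable (B `\` C) by exact: measurableD.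
  have CA := subset_trans CB BA.
  have BCA : B `\` C `<=` A by move=> x [/BA].
  have pos D : measurable D -> D `<=` A -> mu D <> 0%E -> 0 < m D.
    move=> mD' DA D0; rewrite lt_neqAle m_ge0 andbT eq_sym.
    by apply/eqP => D0'; apply: D0; rewrite mE// D0'.
  have sum : m C + m (B `\` C) = m B.
    rewrite -mD//; first by rewrite setDUK.
    by move=> x [Bx nCx]; split=> //; exact: BA.
  have [le|/ltW le] := lerP (m C) (m (B `\` C)).
    by exists C; split=> //; [exact: pos|lra].
  by exists (B `\` C); split=> //; [exact: pos|lra].
have m0 : 0 < m S by rewrite -lte_fin -mE.
have iter_half n : exists C, [/\ measurable C, C `<=` S, 0 < m C & m C <= m S / 2 ^+ n].
  elim: n => [|n [C [mC CS C0 Cn]]]; first by exists S; split=> //; rewrite expr0 divr1.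
  have [C' [mC' C'C C'0 C'n]] := half C mC (subset_trans CS SA) C0.
  exists C'; split=> //; first exact: subset_trans C'C CS.
  apply: le_trans C'n _; rewrite exprSr invfM mulrA.
  by rewrite ler_pM2r.
have [n ne] : exists n, m S / 2 ^+ n <= e.
  exists (Num.truncn (m S / e)).+1; rewrite ler_pdivrMr ?exprn_gt0// mulrC -ler_pdivrMr//.
  apply: ltW; apply: lt_trans (truncnS_gt _) _.
  by rewrite -natrX ltr_nat ltn_expl.
have [C [mC CS C0 Cn]] := iter_half n.
have CA := subset_trans CS SA.
exists C; split=> //; rewrite mE// ?lte_fin// lee_fin.
exact: le_trans Cn ne.
Qed.

(* Greedy construction: enlarge the set by at least half of what still fits
   below [c]. *)
Lemma Sierpinski (c : R) : 0 <= c -> (c%:E <= mu A)%E ->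
  exists B, [/\ measurable B, B `<=` A & mu B = c%:E].
Proof.
move=> c0; rewrite mE// lee_fin => cA.
pose fits B C := [/\ measurable C, C `<=` A `\` B & m B + m C <= c].
have /choice[step stepP] : forall B, exists C, m B <= c ->
    fits B C /\ forall C', fits B C' -> m C' <= 2 * m C.
  move=> B; have [Bc|] := boolP (m B <= c); last by exists set0.
  have fit0 : fits B set0 by split=> //; rewrite /m measure0 addr0.
  pose s := sup [set m C | C in fits B].
  have hs : has_sup [set m C | C in fits B].
    split; first by exists (m set0), set0.
    by exists c => _ [C [_ _ BC] <-]; have := m_ge0 B; lra.
  have sub C : fits B C -> m C <= s.
    by move=> BC; apply: ub_le_sup; [case: hs|exists C].
  have s0 : 0 <= s by apply: le_trans (sub _ fit0); exact: m_ge0.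
  have [sE|sN] := eqVneq s 0.
    (* If the supremum is 0, every set that fits is null and the empty set is already optimal. *)
    exists set0 => _; split=> // C /sub; rewrite sE => /le_trans; apply.
    by rewrite mulr_ge0.
  have [|_ [C BC <-] sC] := @sup_adherent _ _ (s / 2) _ hs.
    by rewrite divr_gt0// lt_neqAle eq_sym sN.
  by exists C => _; split=> // C' /sub; move: sC; rewrite -/s; lra.
pose F n := iter n (fun B => B `|` step B) set0.
have FP n : [/\ measurable (F n), F n `<=` A & m (F n) <= c].
  elim: n => [|n [mF FA Fc]]; first by split; rewrite /F /= /m ?measure0.
  have [[mC CA FC] _] := stepP _ Fc; split; first exact: measurableU.
    by move=> x [/FA//|/CA[]].
  by rewrite /= mD.
have Fsub n : F n `<=` F n.+1 by move=> x Fx; left.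
have ndF : nondecreasing_seq F.
  by apply/nondecreasing_seqP => n; apply/subsetPset; exact: Fsub.
pose B := \bigcup_n F n.
have mB : measurable B by apply: bigcup_measurable => n _; have [] := FP n.
have BA : B `<=` A by move=> x [n _]; have [_ FA _] := FP n => /FA.
exists B; split=> //; rewrite mE//; congr EFin; apply/eqP; rewrite eq_le.
have Bc : m B <= c.
  rewrite -lee_fin -mE//.
  have cvg : mu \o F @ \oo --> mu B.
    by apply: nondecreasing_cvg_mu => // n; have [] := FP n.
  rewrite -(cvg_lim _ cvg)//; apply: lime_le; first by apply/cvg_ex; exists (mu B).
  by near=> n; have [mF FA Fc] := FP n; rewrite /= mE// lee_fin.
(* If [m B < c], some [C] of positive measure outside [B] fits at every stage. Each stage then adds
   at least [m C / 2], and [m (F n)] eventually exceeds [c]. *)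
rewrite Bc leNgt; apply/negP => lt.
have mAB : measurable (A `\` B) by exact: measurableD.
have ABA : A `\` B `<=` A by move=> x [].
have AB0 : (0 < mu (A `\` B))%E.
  rewrite mE// lte_fin; have := mD mB mAB BA (@subset_refl _ _).
  by rewrite setDUK//; lra.
have [|C [mC CAB C0 Cc]] := non_atomic_small mAB ABA AB0 (e := c - m B).
  by rewrite subr_gt0.
have CA := subset_trans CAB ABA.
move: C0 Cc; rewrite mE// lte_fin lee_fin => C0 Cc.
have grow n : n%:R * (m C / 2) <= m (F n).
  elim: n => [|n IH]; first by rewrite mul0r m_ge0.
  have [mF FA Fc] := FP n; have [[mS SA FS] max] := stepP _ Fc.
  have FB : F n `<=` B by move=> x Fx; exists n.
  have : fits (F n) C.
    split=> //; first by move=> x /CAB[Ax nBx]; split=> // /FB.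
    by have := mS_le mF mB FB BA; lra.
  by move=> /max; rewrite [F n.+1]/= -/(F n) mD// -(natr1 n); lra.
have [_ _] := FP (Num.truncn (c / (m C / 2))).+1.
apply/negP; rewrite -ltNge; apply: lt_le_trans (grow _).
by rewrite -ltr_pdivrMr ?divr_gt0// truncnS_gt.
Unshelve. all: by end_near. Qed.

End Sierpinski.

(** * Approximating convex combinations of integrals by one integral *)

Section Splitting.
Context (d : measure_display) (X : measurableType d) (R : realType).
Context (mu : {measure set X -> \bar R}).
Hypothesis na : non_atomic mu.
Variables (J : Type) (q : J -> X -> R) (N : J -> R).
Hypotheses (mq : forall j, measurable_fun setT (q j)) (q0 : forall j t, 0 <= q j t).
Hypothesis N0 : forall j, 0 <= N j.
Variables (E1 E2 : set X) (l : R).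
Hypotheses (mE1 : measurable E1) (mE2 : measurable E2) (l0 : 0 <= l) (l1 : l <= 1).

Local Notation I E j := (\int[mu]_(t in E) (q j t)%:E)%E.

Definition mix A j : \bar R := (l%:E * I (A `&` E1) j + (1 - l)%:E * I (A `&` E2) j)%E.

(** One [B] serves all [j]: with [j] a vector and [N j] its squared norm, this uniformity becomes an
    operator-norm bound. Two additive inequalities avoid subtraction of extended reals. *)
Definition splits (A B : set X) (e : \bar R) : Prop :=
  [/\ measurable B, B `<=` A,
      forall j, (I B j <= mix A j + e * (N j)%:E)%E &
      forall j, (mix A j <= I B j + e * (N j)%:E)%E].

Let mqE D j : measurable D -> measurable_fun D (EFin \o q j).
Proof. by move=> mD; apply/measurable_EFinP; apply: measurable_funTS. Qed.

Let I_ge0 D j : (0 <= I D j)%E.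
Proof. by apply: integral_ge0 => t _; rewrite lee_fin. Qed.

Let mix_ge0 A j : (0 <= mix A j)%E.
Proof. by rewrite adde_ge0// mule_ge0// lee_fin// subr_ge0. Qed.

Let I_bigcup (F : nat -> set X) j : (forall i, measurable (F i)) ->
  trivIset setT F -> I (\bigcup_i F i) j = (\sum_(i <oo) I (F i) j)%E.
Proof.
move=> mF tF; apply: ge0_integral_bigcup => //.
  by apply: mqE; exact: bigcup_measurable.
by move=> t _; rewrite lee_fin.
Qed.

(** All terms are nonnegative and countably additive over disjoint pieces, so the errors add up. *)
Lemma splits_bigcup (F B : nat -> set X) (e : nat -> \bar R) :
  (forall i, measurable (F i)) -> trivIset setT F -> (forall i, 0 <= e i)%E ->
  (forall i, splits (F i) (B i) (e i)) ->
  splits (\bigcup_i F i) (\bigcup_i B i) (\sum_(i <oo) e i)%E.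
Proof.
move=> mF tF e0 sFB.
have mB i : measurable (B i) by have [] := sFB i.
have BF i : B i `<=` F i by have [] := sFB i.
have tB : trivIset setT B.
  by move=> i j _ _ [t [Bi Bj]]; apply: tF => //; exists t; split; exact: BF.
have mixE j : mix (\bigcup_i F i) j = (\sum_(i <oo) mix (F i) j)%E.
  rewrite /mix !setI_bigcupl !I_bigcup; first last.
  - by apply: trivIset_setIr.
  - by move=> i; exact: measurableI.
  - by apply: trivIset_setIr.
  - by move=> i; exact: measurableI.
  rewrite (@nneseriesD R (fun i => l%:E * I (F i `&` E1) j)%E
    (fun i => (1 - l)%:E * I (F i `&` E2) j)%E xpredT 0%N).
  - by rewrite !nneseriesZl.
  - by move=> i _ _; rewrite mule_ge0// lee_fin.
  - by move=> i _ _; rewrite mule_ge0// lee_fin subr_ge0.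
have sumE j : ((\sum_(i <oo) e i) * (N j)%:E = \sum_(i <oo) (e i * (N j)%:E))%E.
  rewrite muleC -nneseriesZl//; apply: eq_eseriesr => i _.
  by rewrite muleC.
split=> [||j|j].
- exact: bigcup_measurable.
- by move=> t [i _ /BF Ft]; exists i.
- rewrite mixE sumE I_bigcup// -nneseriesD => [||i _ _]; first last.
  - by rewrite mule_ge0// lee_fin.
  - by move=> i _ _; exact: mix_ge0.
  by apply: lee_nneseries => // i _; have [_ _ + _] := sFB i; exact.
- rewrite mixE sumE I_bigcup// -nneseriesD => [||i _ _]; first last.
  - by rewrite mule_ge0// lee_fin.
  - by move=> i _ _; exact: I_ge0.
  by apply: lee_nneseries => // i _; have [_ _ _ +] := sFB i; exact.
Qed.

Lemma splits_le A B e e' : (e <= e')%E -> splits A B e -> splits A B e'.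
Proof.
move=> ee [mB BA h1 h2]; split=> // j.
  by apply: le_trans (h1 j) _; rewrite leeD2l// lee_wpmul2r// lee_fin.
by apply: le_trans (h2 j) _; rewrite leeD2l// lee_wpmul2r// lee_fin.
Qed.

(** Up to [e * N j] times the measure, the integral of [q j] is [s j] times the measure. So a [B] of
    measure [l * a1 + (1 - l) * a2] suits every [j] at once; the factor 2 counts the error on each
    side. *)
Lemma splits_nearly_constant A (s : J -> R) (e : R) :
  measurable A -> (mu A < +oo)%E -> 0 <= e -> (forall j, 0 <= s j) ->
  (forall t j, A t -> `|q j t - s j| <= e * N j) ->
  exists B, splits A B ((2 * e)%:E * mu A)%E.
Proof.
move=> mA Afin e0 s0 near.
have fin C : measurable C -> C `<=` A -> mu C = (fine (mu C))%:E.
  move=> mC CA; rewrite fineK// ge0_fin_numE//.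
  by apply: le_lt_trans Afin; apply: le_measure; rewrite ?inE.
have eN j : 0 <= e * N j by rewrite mulr_ge0.
have upper C j : measurable C -> C `<=` A -> (I C j <= ((s j + e * N j) * fine (mu C))%:E)%E.
  move=> mC CA; rewrite EFinM -fin// -(integral_cst mu mC).
  apply: ge0_le_integral => //.
  - by move=> t _; rewrite lee_fin.
  - exact: mqE.
  - by move=> t /CA At; rewrite lee_fin; move: (near t j At); rewrite ler_norml; lra.
have lower C j : measurable C -> C `<=` A ->
    ((s j * fine (mu C))%:E <= I C j + (e * N j * fine (mu C))%:E)%E.
  move=> mC CA; rewrite !EFinM -fin// -EFinM -!(integral_cst mu mC).
  rewrite -ge0_integralD//; last 3 first.
  - by move=> t _; rewrite lee_fin.
  - exact: mqE.
  - by move=> t _; rewrite lee_fin.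
  apply: ge0_le_integral => //.
  - by move=> t _; rewrite lee_fin.
  - by apply: emeasurable_funD => //; exact: mqE.
  - move=> t /CA At; rewrite -EFinD lee_fin; move: (near t j At).
    by rewrite ler_norml; lra.
pose a1 := fine (mu (A `&` E1)); pose a2 := fine (mu (A `&` E2)); pose a := fine (mu A).
have mA1 : measurable (A `&` E1) by exact: measurableI.
have mA2 : measurable (A `&` E2) by exact: measurableI.
have A1A : A `&` E1 `<=` A by move=> t [].
have A2A : A `&` E2 `<=` A by move=> t [].
have a1a : 0 <= a1 <= a.
  by rewrite fine_ge0// -lee_fin -!fin//; apply: le_measure; rewrite ?inE.
have a2a : 0 <= a2 <= a.
  by rewrite fine_ge0// -lee_fin -!fin//; apply: le_measure; rewrite ?inE.
pose c := l * a1 + (1 - l) * a2.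
have l1' : 0 <= 1 - l by rewrite subr_ge0.
have [c0 ca] : 0 <= c /\ c <= a.
  case/andP: a1a => a10 a1a; case/andP: a2a => a20 a2a; rewrite /c; split.
    by rewrite addr_ge0// mulr_ge0.
  by have := ler_wpM2l l0 a1a; have := ler_wpM2l l1' a2a; lra.
have [|B [mB BA Bc]] := Sierpinski na mA Afin c0; first by rewrite fin ?lee_fin.
have fI C j : measurable C -> C `<=` A -> I C j = (fine (I C j))%:E.
  move=> mC CA; rewrite fineK// ge0_fin_numE//.
  by apply: le_lt_trans (upper C j mC CA) _; rewrite ltry.
exists B; split=> // j.
- have := upper B j mB BA; have := lower _ j mA1 A1A; have := lower _ j mA2 A2A.
  rewrite /mix Bc (fin A)// -/a (fI B)// (fI (A `&` E1))// (fI (A `&` E2))//.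
  rewrite -!EFinM -!EFinD !lee_fin /= -/a1 -/a2.
  move: (fine (I _ _)) (fine (I _ _)) (fine (I _ _)) => x1 x2 x h2 h1 h.
  have := ler_wpM2l l0 h1; have := ler_wpM2l l1' h2 => {}h2 {}h1.
  have := ler_wpM2l (eN j) ca; rewrite /c in h *.
  by lra.
- have := lower B j mB BA; have := upper _ j mA1 A1A; have := upper _ j mA2 A2A.
  rewrite /mix Bc (fin A)// -/a (fI B)// (fI (A `&` E1))// (fI (A `&` E2))//.
  rewrite -!EFinM -!EFinD !lee_fin /= -/a1 -/a2.
  move: (fine (I _ _)) (fine (I _ _)) (fine (I _ _)) => x1 x2 x h2 h1 h.
  have := ler_wpM2l l0 h1; have := ler_wpM2l l1' h2 => {}h2 {}h1.
  have := ler_wpM2l (eN j) ca; rewrite /c in h *.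
  by lra.
Qed.

(** Make the sets [G k] disjoint, treat each piece as nearly constant, and sum: the measures of the
    pieces add up to [mu A]. *)
Lemma splits_countably_many_values A (G : nat -> set X) (s : nat -> J -> R) (e : R) :
  measurable A -> (mu A < +oo)%E -> 0 <= e -> (forall k j, 0 <= s k j) ->
  (forall k, measurable (G k)) -> A `<=` \bigcup_k G k ->
  (forall k t j, G k t -> `|q j t - s k j| <= e * N j) ->
  exists B, splits A B ((2 * e)%:E * mu A)%E.
Proof.
move=> mA Afin e0 s0 mG AG near.
pose F k := A `&` seqDU G k.
have mS k : measurable (seqDU G k).
  by apply: measurableD => //; exact: bigsetU_measurable.
have mF k : measurable (F k) by exact: measurableI.
have tF : trivIset setT F by apply: trivIset_setIl; exact: trivIset_seqDU.
have FA : \bigcup_k F k = A.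
  rewrite -setI_bigcupr -seqDU_bigcup_eq; apply/seteqP; split=> [t []//|t At].
  by split=> //; exact: AG.
have /choice[B BP] : forall k, exists B, splits (F k) B ((2 * e)%:E * mu (F k))%E.
  move=> k; apply: splits_nearly_constant (s0 k) _ => //.
    by apply: le_lt_trans Afin; apply: le_measure; rewrite ?inE// => t [].
  by move=> t j [_ [Gt _]]; exact: near.
exists (\bigcup_k B k).
have -> : ((2 * e)%:E * mu A = \sum_(k <oo) (2 * e)%:E * mu (F k))%E.
  by rewrite nneseriesZl// -measure_semi_bigcup// ?FA.
rewrite -{1}FA; apply: splits_bigcup => // k.
by rewrite mule_ge0// lee_fin mulr_ge0.
Qed.

(** The covering may depend on [r], so [r] is adapted to the measure of each disjoint piece and the
    errors form a geometric series of sum [e]. *)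
Lemma splits_sigma_finite (G : nat -> set X) (e : R) : 0 < e ->
  (forall n, measurable (G n)) -> (forall n, mu (G n) < +oo)%E ->
  (forall r, 0 < r -> exists (H : nat -> set X) (s : nat -> J -> R),
    [/\ forall k, measurable (H k), \bigcup_k H k = setT, forall k j, 0 <= s k j &
        forall k t j, H k t -> `|q j t - s k j| <= r * N j]) ->
  exists B, splits (\bigcup_n G n) B e%:E.
Proof.
move=> e0 mG Gfin HP.
have mS k : measurable (seqDU G k).
  by apply: measurableD => //; exact: bigsetU_measurable.
have Sfin n : (mu (seqDU G n) < +oo)%E.
  by apply: le_lt_trans (Gfin n); apply: le_measure; rewrite ?inE// => t [].
have /choice[B BP] : forall n, exists B,
    splits (seqDU G n) B (e / (2 ^ n.+1)%:R)%:E.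
  move=> n; pose a := fine (mu (seqDU G n)).
  have aE : mu (seqDU G n) = a%:E by rewrite fineK// ge0_fin_numE.
  have a0 : 0 <= a by exact: fine_ge0.
  pose e' := e / (2 ^ n.+1)%:R.
  have e'0 : 0 < e' by rewrite divr_gt0// ltr0n expn_gt0.
  (* This gives [2 * r * a <= e']; [a + 1] allows for null pieces. *)
  pose r := e' / (2 * (a + 1)).
  have r0 : 0 < r by rewrite divr_gt0// mulr_gt0//; lra.
  have [H [s [mH HT s0 Hs]]] := HP r r0.
  have HS : seqDU G n `<=` \bigcup_k H k by rewrite HT.
  have [B BP] := splits_countably_many_values (mS n) (Sfin n) (ltW r0) s0 mH HS Hs.
  exists B; apply: splits_le BP; rewrite aE -EFinM lee_fin -/e'.
  have -> : 2 * r * a = e' * (a / (a + 1)) by rewrite /r; field; lra.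
  rewrite ler_piMr//; first exact: ltW.
  by rewrite ler_pdivrMr; lra.
exists (\bigcup_n B n); rewrite seqDU_bigcup_eq.
apply: splits_le (splits_bigcup mS (@trivIset_seqDU _ G) _ BP).
  by apply: (epsilon_trick0 xpredT); exact: ltW.
by move=> n; rewrite lee_fin divr_ge0// ltW.
Qed.

End Splitting.

(** * Reduction to the real part of the inner product *)

Section OperatorNorm.
Variables (R : realType) (W : lmodType R) (b : W -> W -> R).
Hypothesis pb : psd_form b.

(** Subtracting the bounds at [a *: f + g] and [- a *: f + g] isolates the cross term ([young]),
    which is then used with [g = K f]. Linearity is stated after pairing because [K] will be known
    through weak integrals. *)
Lemma symmetric_op_norm_le (K : W -> W) (e : R) : 0 < e ->
  (forall a f g h, b (K (a *: f + g)) h = a * b (K f) h + b (K g) h) ->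
  (forall f g, b (K f) g = b (K g) f) ->
  (forall f, `|b (K f) f| <= e * b f f) ->
  forall f, fnorm b (K f) <= e * fnorm b f.
Proof.
move=> e0 lin sym quad f.
pose k f g := b (K f) g.
have kE a g : k (a *: f + g) (a *: f + g) = a ^+ 2 * k f f + 2 * a * k f g + k g g.
  by rewrite /k lin !(formDr pb) !(formZr pb) (sym g f); ring.
have bE a g : b (a *: f + g) (a *: f + g) = a ^+ 2 * b f f + 2 * a * b f g + b g g.
  by rewrite !(formE pb) (formC pb g f); ring.
have young a g : 2 * a * k f g <= e * (a ^+ 2 * b f f + b g g).
  have := quad (a *: f + g); have := quad (- a *: f + g).
  rewrite -!/(k _ _) !kE !bE !ler_norml => /andP[h1 h2] /andP[h3 h4].
  by lra.
have [F0|F0] := eqVneq (b f f) 0.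
  have [g0|g0] := eqVneq (b (K f) (K f)) 0.
    by rewrite /fnorm g0 sqrtr0 mulr_ge0 ?sqrtr_ge0// ltW.
  (* For [f] of norm zero the left side of [young] is unbounded in [a]; this [a] makes it exceed the
     right side by 1. *)
  have := young ((e * b (K f) (K f) + 1) / (2 * b (K f) (K f))) (K f).
  rewrite F0 mulr0 add0r {1}/k.
  have -> : 2 * ((e * b (K f) (K f) + 1) / (2 * b (K f) (K f))) * b (K f) (K f) =
    e * b (K f) (K f) + 1 by field.
  by lra.
have F1 : 0 < b f f by rewrite lt_neqAle eq_sym F0 form_ge0.
rewrite fnormP ?mulr_ge0 ?fnorm_ge0 ?(ltW e0)//.
rewrite exprMn sqr_fnorm//.
set F := b f f in F0 F1 young *; set G := b (K f) (K f).
(* The optimal [a], maximising [2 * a * G - e * a ^+ 2 * F]. *)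
have := young (e^-1 * (G / F)) (K f); rewrite -/G {1}/k -/G.
have [->|G0] := eqVneq G 0; first by rewrite mulr_ge0// ?sqr_ge0// ltW.
have G1 : 0 < G by rewrite lt_neqAle eq_sym G0 form_ge0.
have -> : 2 * (e^-1 * (G / F)) * G = 2 * (G ^+ 2 / (e * F)) by field; rewrite ?F0 ?gt_eqF.
have -> : e * ((e^-1 * (G / F)) ^+ 2 * F + G) = G ^+ 2 / (e * F) + e * G.
  by field; rewrite ?F0 ?gt_eqF.
move=> h; have : G ^+ 2 / (e * F) <= e * G by lra.
rewrite ler_pdivrMr ?mulr_gt0// expr2 => {}h.
by rewrite -(ler_pM2r G1); apply: le_trans h _;
  rewrite [leLHS](_ : _ = e ^+ 2 * F * G)//; ring.
Qed.

End OperatorNorm.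

(* [V] as a real vector space: all the estimates only involve the real part
   of the inner product. *)
Definition realified (R : realType) (V : lmodType R[i]) : Type := V.

Section Realified.
Variables (R : realType) (V : lmodType R[i]).

HB.instance Definition _ := GRing.Zmodule.copy (realified V) V.

Definition real_scale (a : R) (v : realified V) : realified V := (a%:C)%C *: (v : V).

Lemma real_scaleA a c v : real_scale a (real_scale c v) = real_scale (a * c) v.
Proof. by rewrite /real_scale scalerA rmorphM. Qed.

Lemma real_scale1 : left_id 1 real_scale.
Proof. by move=> v; rewrite /real_scale rmorph1 scale1r. Qed.

Lemma real_scaleDr : right_distributive real_scale +%R.
Proof. by move=> a u v; rewrite /real_scale scalerDr. Qed.

Lemma real_scaleDl v : {morph real_scale^~ v : a c / a + c}.
Proof. by move=> a c; rewrite /real_scale rmorphD scalerDl. Qed.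

HB.instance Definition _ := GRing.Zmodule_isLmodule.Build R (realified V)
  real_scaleA real_scale1 real_scaleDr real_scaleDl.

End Realified.

(** * The real part of the inner product *)

Section RealPart.
Variables (R : realType) (V : lmodType R[i]) (ip : V -> V -> R[i]).
Hypothesis ipP : is_inner_product ip.

Definition rip (f g : realified V) : R := cRe (ip f g).

Lemma ipDl f g h : ip (f + g) h = ip f h + ip g h.
Proof. by have [lin _ _ _] := ipP; rewrite -[f]scale1r lin mul1r scale1r. Qed.

Lemma ipZl a f h : ip (a *: f) h = a * ip f h.
Proof.
have [lin _ _ _] := ipP.
have ip0 : ip 0 h = 0.
  by have := lin (-1) 0 0 h; rewrite scaler0 addr0 mulN1r addNr.
by have := lin a f 0 h; rewrite ip0 !addr0.
Qed.

Lemma ipC f g : ip g f = conjc (ip f g). Proof. by have [_ -> _ _] := ipP. Qed.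

Lemma ipDr f g h : ip h (f + g) = ip h f + ip h g.
Proof. by rewrite ipC ipDl rmorphD /= -!ipC. Qed.

Lemma ipZr a f h : ip h (a *: f) = conjc a * ip h f.
Proof. by rewrite ipC ipZl rmorphM /= -ipC. Qed.

Lemma rip_psd : psd_form rip.
Proof.
split=> [a f g h|f g|f].
- rewrite /rip ipDl /GRing.scale /= /real_scale ipZl.
  by case: (ip f h) (ip g h) => [x y] [z w]; rewrite /cRe /= mul0r subr0.
- by rewrite /rip ipC; case: (ip g f).
- by have [_ _ pos _] := ipP; have := pos f; rewrite lecE => /andP[].
Qed.

Lemma hnormE : hnorm ip = fnorm rip. Proof. by []. Qed.

(** The inner product is conjugate linear in its second argument. Identities for real parts thereby
    carry over to imaginary parts. *)
Lemma cIm_ip f g : cIm (ip f g) = rip f ('i%C *: g).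
Proof.
by rewrite /rip ipZr; case: (ip f g) => x y; rewrite /cRe /cIm /=; ring.
Qed.

(** Complex polarization: the form is real on the diagonal, and testing this at [f + g] relates the
    imaginary parts; replacing [g] by ['i *: g] turns them into real parts. *)
Lemma positive_op_sym A : linear_op A -> positive_op ip A ->
  forall f g, rip (A f) g = rip (A g) f.
Proof.
move=> lin pos.
have AD f g : A (f + g) = A f + A g by have := lin 1 f g; rewrite !scale1r.
have A0 : A 0 = 0 by have := lin (-1) 0 0; rewrite scaler0 addr0 scaleN1r addNr.
have AZ a f : A (a *: f) = a *: A f by have := lin a f 0; rewrite A0 !addr0.
have im f : cIm (ip (A f) f) = 0 by exact: ger0_Im.
have im2 f g : cIm (ip (A f) g) + cIm (ip (A g) f) = 0.
  have := im (f + g); rewrite AD !ipDl !ipDr; have := im f; have := im g.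
  case: (ip (A f) f) (ip (A g) g) (ip (A f) g) (ip (A g) f).
  by move=> ? ? [? ?] [? ?] [? ?]; rewrite /cIm /=; lra.
move=> f g; have := im2 f ('i%C *: g); rewrite AZ ipZl ipZr /rip.
by case: (ip (A f) g) (ip (A g) f) => [x y] [z w]; rewrite /cIm /cRe /=; lra.
Qed.

Lemma psd_compact_realified (A : V -> V) :
  positive_compact_op ip A -> psd_compact rip A.
Proof.
move=> [pos [[lin bnd] cpt]]; split=> //.
  by move=> a f g; exact: lin.
split=> [a f g h|f g|f].
- rewrite -[A _]/(A ((a%:C)%C *: (f : V) + (g : V))) lin.
  by have [rlin _ _] := rip_psd; exact: (rlin a).
- exact: positive_op_sym.
- by have := pos f; rewrite lecE => /andP[].
Qed.

End RealPart.

(** * The operators Phi(E) *)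

Lemma measurable_set_le (d : measure_display) (X : measurableType d) (R : realType)
    (f g : X -> R) :
  measurable_fun setT f -> measurable_fun setT g -> measurable [set t | f t <= g t].
Proof.
move=> mf mg.
have m1 : measurable [set true] by [].
have := measurable_fun_ler mf mg measurableT m1.
by rewrite setTI; congr measurable; apply/seteqP; split.
Qed.

Lemma measurable_set_lt (d : measure_display) (X : measurableType d) (R : realType)
    (f g : X -> R) :
  measurable_fun setT f -> measurable_fun setT g -> measurable [set t | f t < g t].
Proof.
move=> mf mg.
have m1 : measurable [set true] by [].
have := measurable_fun_ltr mf mg measurableT m1.
by rewrite setTI; congr measurable; apply/seteqP; split.
Qed.

(** Markov's inequality. *)
Lemma integral_gt_set_fin (d : measure_display) (X : measurableType d) (R : realType)
    (mu : {measure set X -> \bar R}) (f : X -> R) (r : R) :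
  measurable_fun setT f -> (forall t, 0 <= f t) ->
  (\int[mu]_t (f t)%:E < +oo)%E -> 0 < r -> (mu [set t | (r < f t)%R] < +oo)%E.
Proof.
move=> mf f0 ffin r0.
have mG : measurable [set t | (r < f t)%R] by exact: measurable_set_lt.
have mfE (D : set X) : measurable_fun D (EFin \o f).
  by apply/measurable_EFinP; exact: measurable_funTS.
have : (r%:E * mu [set t | (r < f t)%R] < +oo)%E.
  apply: le_lt_trans ffin; rewrite -integral_cst//.
  apply: (@le_trans _ _ (\int[mu]_(t in [set t | (r < f t)%R]) (f t)%:E)%E).
    apply: ge0_le_integral => //.
    - by move=> t _; rewrite lee_fin ltW.
    - by move=> t /= rt; rewrite lee_fin ltW.
  by apply: ge0_subset_integral => // t _; rewrite lee_fin.
case: (mu _) (measure_ge0 mu [set t | (r < f t)%R]) => [x _ _|_|//]; first by rewrite ltry.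
by rewrite gt0_muley ?lte_fin.
Qed.

(** * Integrability and existence of the weak integrals *)

Section Bessel.
Context (R : realType) (V : lmodType R[i]) (ip : V -> V -> R[i]).
Context (d : measure_display) (X : measurableType d) (mu : {measure set X -> \bar R}).
Context (T : X -> V -> V).
Hypotheses (ipP : is_inner_product ip) (besT : bessel_family mu ip T).

Local Notation W := (realified V).
Local Notation b := (rip ip).
Let pb : psd_form b := rip_psd ipP.

Definition quad (f : W) (t : X) : R := b (T t f) f.

Definition Phi_form (E : set X) (f g : W) : R := Rintegral mu E (fun t => b (T t f) g).

Lemma family_psd_compact t : psd_compact b (T t : W -> W).
Proof. by apply: psd_compact_realified => //; have [+ _ _] := besT; exact. Qed.

Let psdT t : psd_form (fun f g : W => b (T t f) g).
Proof. by have [_ + _ _] := family_psd_compact t. Qed.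

Lemma measurable_rip f g : measurable_fun setT (fun t => b (T t f) g).
Proof. by have [_ + _] := besT => /(_ f g)[]. Qed.

Lemma quad_ge0 f t : 0 <= quad f t.
Proof. exact: (form_ge0 (psdT t)). Qed.

Lemma quad_bound : exists2 B, 0 < B &
  forall f, (\int[mu]_t (quad f t)%:E <= (B * b f f)%:E)%E.
Proof.
have [_ _ [B [B0 BP]]] := besT; exists B => // f.
by have := BP f; rewrite hnormE sqr_fnorm.
Qed.

Lemma quad_fin f : (\int[mu]_t (quad f t)%:E < +oo)%E.
Proof. by have [B _ /(_ f)/le_lt_trans] := quad_bound; apply; rewrite ltry. Qed.

Lemma quad_integrable E f : measurable E -> mu.-integrable E (EFin \o quad f).
Proof.
move=> mE; apply: (@integrableS _ _ _ mu setT) => //; apply/integrableP; split.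
  by apply/measurable_EFinP; exact: measurable_rip.
under eq_integral do rewrite /= ger0_norm ?quad_ge0//.
exact: quad_fin.
Qed.

(** By polarization the function is a quarter of the difference of two integrable quadratic
    forms. *)
Lemma rip_integrable E (f g : W) : measurable E ->
  mu.-integrable E (EFin \o (fun t => b (T t f) g)).
Proof.
move=> mE.
have -> : EFin \o (fun t => b (T t f) g) =
    (fun t => (4^-1)%:E * ((EFin \o quad (f + g)%R) \- (EFin \o quad (f - g)%R)) t)%E.
  apply/funext => t /=; rewrite -EFinB -EFinM; congr EFin.
  rewrite /quad; have := formC (psdT t) f g.
  have := formDl (psdT t) f g (f + g); have := formBl (psdT t) f g (f - g) => /= -> ->.
  by rewrite !(formDr pb) !(formNr pb) => /= ->; field.
by apply: integrableZl => //; apply: integrableB => //; exact: quad_integrable.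
Qed.

Lemma Phi_form_psd E : measurable E -> psd_form (Phi_form E).
Proof.
move=> mE; split=> [a f g h|f g|f].
- rewrite /Phi_form -RintegralZl//; last exact: rip_integrable.
  rewrite -RintegralD//; last 2 first.
  + have -> : EFin \o (fun t => a * b (T t f) h) =
        (fun t => a%:E * (EFin \o (fun t => b (T t f) h)) t)%E by [].
    by apply: integrableZl => //; exact: rip_integrable.
  + exact: rip_integrable.
  by apply: eq_Rintegral => t _; have [+ _ _] := psdT t => ->.
- by apply: eq_Rintegral => t _; have := formC (psdT t) f g.
- by apply: Rintegral_ge0 => t _; exact: quad_ge0.
Qed.

Lemma Phi_form_EFin E f : measurable E ->
  ((Phi_form E f f)%:E = \int[mu]_(t in E) (quad f t)%:E)%E.
Proof.
move=> mE; rewrite /Phi_form /Rintegral fineK//.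
by apply: integrable_fin_num => //; exact: quad_integrable.
Qed.

Lemma is_Phi_rip E P f g : is_Phi mu ip T E P -> b (P f) g = Phi_form E f g.
Proof. by move=> PP; rewrite /rip PP. Qed.

(** Riesz representation for each [f]: Cauchy-Schwarz for [Phi_form E] and the Bessel bound make the
    functional bounded. This settles real parts, and [cIm_ip] the imaginary ones. *)
Lemma is_Phi_exists E : measurable E -> hilbert_complete ip ->
  exists P, is_Phi mu ip T E P.
Proof.
move=> mE cplt; have [B B0 BP] := quad_bound.
have PhiB f : Phi_form E f f <= B * b f f.
  rewrite -lee_fin Phi_form_EFin//; apply: le_trans (BP f).
  apply: ge0_subset_integral => //.
    by apply/measurable_EFinP; exact: measurable_rip.
  by move=> t _; rewrite lee_fin quad_ge0.
have psdE := Phi_form_psd mE.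
have /choice[P PP] : forall f, exists v : W, forall g, b v g = Phi_form E f g.
  move=> f; apply: (@Riesz_representation _ _ _ pb (Phi_form E f) (B * fnorm b f)) => //.
    by move=> a g h; rewrite formDr// formZr.
  move=> g; apply: le_trans (form_le psdE f g) _.
  rewrite -mulrA -[B in leRHS]sqr_sqrtr ?(ltW B0)// expr2 mulrACA.
  have le h : fnorm (Phi_form E) h <= Num.sqrt B * fnorm b h.
    by rewrite /fnorm -sqrtrM ?(ltW B0)// ler_wsqrtr.
  by rewrite ler_pM ?fnorm_ge0.
exists P => f g; rewrite /cintegral.
have -> : Rintegral mu E (fun t => cRe (ip (T t f) g)) = cRe (ip (P f) g).
  by symmetry; exact: PP.
have -> : Rintegral mu E (fun t => cIm (ip (T t f) g)) = cIm (ip (P f) g).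
  by rewrite cIm_ip// PP; apply: eq_Rintegral => t _; rewrite cIm_ip.
by case: (ip (P f) g).
Qed.

End Bessel.

(** * Convexity *)

Lemma dense_sequence (R : realType) (V : lmodType R[i]) (ip : V -> V -> R[i]) :
  hilbert_separable ip -> exists D : nat -> V,
    forall f e, 0 < e -> exists n, hnorm ip (f - D n) < e.
Proof.
move=> [S [/countable_injP[c cinj] Sdense]].
have /choice[D DP] : forall n, exists v, forall x, S x -> c x = n -> v = x.
  move=> n; have [[x [Sx cx]]|no] := pselect (exists x, S x /\ c x = n).
    by exists x => y Sy cy; apply: cinj; rewrite ?inE// cx.
  (* Default for integers that number no element of [S]. *)
  by exists 0 => x Sx cx; exfalso; apply: no; exists x.
exists D => f e /(Sdense f)[x [Sx fx]]; exists (c x).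
by rewrite (DP _ x).
Qed.

Section Convexity.
Context (R : realType) (V : lmodType R[i]) (ip : V -> V -> R[i]).
Context (d : measure_display) (X : measurableType d) (mu : {measure set X -> \bar R}).
Context (T : X -> V -> V).
Hypotheses (hilb : separable_hilbert_space ip) (na : non_atomic mu).
Hypothesis besT : bessel_family mu ip T.

Let ipP : is_inner_product ip. Proof. by have [] := hilb. Qed.
Local Notation W := (realified V).
Local Notation b := (rip ip).
Let pb : psd_form b := rip_psd ipP.
Local Notation q := (@quad R V ip d X T).
Let q0 := quad_ge0 ipP besT.

(** Operators close to one of the [S k] play the part of the nearly constant values, on sets of
    finite measure off which the family vanishes. *)
Lemma Phi_range_splits (E1 E2 : set X) (l e : R) :
  measurable E1 -> measurable E2 -> 0 <= l -> l <= 1 -> 0 < e ->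
  exists2 E, measurable E &
    forall f, `|Phi_form ip mu T E f f -
                (l * Phi_form ip mu T E1 f f + (1 - l) * Phi_form ip mu T E2 f f)|
              <= e * b f f.
Proof.
move=> mE1 mE2 l0 l1 e0.
have [_ _ sep] := hilb; have [D Ddense] := dense_sequence sep.
have pcT := family_psd_compact ipP besT.
have mq f : measurable_fun setT (q f) by exact: (measurable_rip besT f f).
(* [k] encodes a pair (n, m), and [G k] is the set where [q (D n)] exceeds 1 / (m + 1); other [k]
   repeat the pair (0, 0). *)
pose G k := let p := odflt (0, 0)%N (unpickle k) in
  [set t | p.2.+1%:R^-1 < q (D p.1) t].
have mG k : measurable (G k) by apply: measurable_set_lt => //; exact: mq.
have Gfin k : (mu (G k) < +oo)%E.
  apply: integral_gt_set_fin; [exact: mq|exact: q0|exact: quad_fin|].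
  by rewrite invr_gt0.
(* The form of [T t] vanishes along the dense sequence, hence everywhere by comparison with the zero
   operator at tolerance 0. *)
have outG t : ~ (\bigcup_k G k) t -> forall f, q f t = 0.
  move=> nG f.
  have qD n : q (D n) t = 0.
    apply/eqP; rewrite eq_le q0 andbT leNgt; apply/negP => pos; apply: nG.
    have [m] := ltr_add_invr pos; rewrite add0r => mP.
    by exists (pickle (n, m)) => //; rewrite /G pickleK /=.
  have on_D n : `|b (T t (D n)) (D n) - b 0 (D n)| <= 0 * b (D n) (D n).
    by rewrite -/(quad ip T (D n) t) qD (form0l pb) subr0 normr0 mul0r.
  have := quadratic_dist_dense pb Ddense (pcT t) (psd_compact0 pb) (lexx 0) on_D f.
  by rewrite mul0r (form0l pb) subr0 normr_le0 => /eqP.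
have [|E [mE EG h1 h2]] := @splits_sigma_finite _ _ _ mu na W q (fun f => b f f)
  mq q0 (form_ge0 pb) E1 E2 l mE1 mE2 l0 l1 G e e0 mG Gfin.
  move=> r r0; have [S [pcS Scover]] := psd_compact_separable pb Ddense r0.
  (* Testing only along [D] gives a countable intersection of measurable sets. *)
  exists (fun k => [set t | forall n,
    `|q (D n) t - b (S k (D n)) (D n)| <= r * b (D n) (D n)]).
  exists (fun k f => b (S k f) f); split.
  - move=> k.
    rewrite (_ : [set t | _] = \bigcap_n
        [set t | `|q (D n) t - b (S k (D n)) (D n)| <= r * b (D n) (D n)]).
      apply: bigcap_measurable => // n _; apply: measurable_set_le => //.
      by apply: measurableT_comp => //; apply: measurable_funB => //; exact: mq.
    by apply/seteqP; split=> t /= h n; [move=> _|]; exact: h.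
  - apply/seteqP; split=> // t _; have [k kP] := Scover _ (pcT t).
    by exists k => //= n; exact: kP.
  - by move=> k f; have [_ psdS _ _] := pcS k; exact: (form_ge0 psdS).
  - move=> k t f Ht.
    exact: (quadratic_dist_dense pb Ddense (pcT t) (pcS k) (ltW r0) Ht f).
exists E => // f.
(* Every [q f] vanishes off the union, so restricting to it leaves the integrals unchanged. *)
have restrict (E' : set X) : measurable E' ->
    (\int[mu]_(t in (\bigcup_k G k) `&` E') (q f t)%:E = (Phi_form ip mu T E' f f)%:E)%E.
  move=> mE'; rewrite Phi_form_EFin//; pose U := \bigcup_k G k.
  have mU : measurable U by apply: bigcup_measurable.
  have -> : (\int[mu]_(t in E') (q f t)%:E =
      \int[mu]_(t in (U `&` E') `|` (E' `\` U)) (q f t)%:E)%E.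
    by rewrite [U `&` E']setIC setUIDK.
  rewrite ge0_integral_setU//; [|exact: measurableI|exact: measurableD| | |].
  - rewrite [X in (_ + X)%E]integral0_eq ?adde0// => t [_ nU].
    by rewrite outG.
  - by apply/measurable_EFinP; apply: measurable_funTS; exact: mq.
  - by move=> t _; rewrite lee_fin.
  - by apply/disj_setPS => t [[Ut _] [_ nU]].
move: (h1 f) (h2 f); rewrite /mix !restrict// -Phi_form_EFin//.
rewrite -!EFinM -!EFinD !lee_fin ler_norml => {}h1 {}h2.
by apply/andP; split; lra.
Qed.

(** Half of [e] goes to approximating [P] and [Q] within the range, half to approximating the
    combination of the approximants by one operator of the range. *)
Lemma op_closure_Phi_range_convex : op_convex ip (op_closure ip (Phi_range mu ip T)).
Proof.
split=> [P []//|P Q [[linP [MP bP]] clP] [[linQ [MQ bQ]] clQ] l /andP[l0 l1]].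
have [_ cplt _] := hilb.
have comb (u v : W) : hnorm ip ((l%:C)%C *: (u : V) + ((1 - l)%:C)%C *: (v : V)) <=
    l * fnorm b u + (1 - l) * fnorm b v.
  rewrite hnormE; apply: le_trans (fnormD pb (l *: u) ((1 - l) *: v)) _.
  by rewrite !(fnormZ pb) !ger0_norm// subr_ge0.
split.
  split=> [a f g|].
    rewrite linP linQ !scalerDr !scalerA addrACA.
    by rewrite ![a * _]mulrC.
  exists (l * MP + (1 - l) * MQ) => f; apply: le_trans (comb _ _) _.
  rewrite [leRHS]mulrDl -!mulrA.
  by rewrite lerD ?ler_wpM2l ?subr_ge0 ?bP ?bQ.
move=> e e0; have e20 : 0 < e / 2 by rewrite divr_gt0.
have [P' [[E1 [mE1 PhiP]] PP']] := clP _ e20.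
have [Q' [[E2 [mE2 PhiQ]] QQ']] := clQ _ e20.
have [E mE quadE] := Phi_range_splits mE1 mE2 l0 l1 e20.
have [S PhiS] := is_Phi_exists ipP besT mE cplt.
exists S; split; first by exists E.
(* Only the quadratic form of this error is controlled so far; its symmetry upgrades the bound to
   the norm. *)
pose K (f : W) : W := S f - (l *: (P' f : W) + (1 - l) *: (Q' f : W)).
have KE f g : b (K f) g = Phi_form ip mu T E f g -
    (l * Phi_form ip mu T E1 f g + (1 - l) * Phi_form ip mu T E2 f g).
  rewrite /K (formBl pb) (formDl pb) !(formZl pb).
  by rewrite (is_Phi_rip _ _ PhiS) (is_Phi_rip _ _ PhiP) (is_Phi_rip _ _ PhiQ).
have psdE := Phi_form_psd ipP besT mE.
have psd1 := Phi_form_psd ipP besT mE1.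
have psd2 := Phi_form_psd ipP besT mE2.
have Kle : forall f, fnorm b (K f) <= e / 2 * fnorm b f.
  refine (symmetric_op_norm_le pb e20 _ _ _).
  - move=> a f g h; rewrite !KE.
    rewrite !(formDl psdE, formZl psdE) !(formDl psd1, formZl psd1).
    by rewrite !(formDl psd2, formZl psd2); ring.
  - by move=> f g; rewrite !KE (formC psdE f) (formC psd1 f) (formC psd2 f).
  - by move=> f; rewrite KE; exact: quadE.
move=> f.
have -> : (l%:C)%C *: P f + ((1 - l)%:C)%C *: Q f - S f =
    ((l%:C)%C *: (P f - P' f) + ((1 - l)%:C)%C *: (Q f - Q' f)) - K f.
  rewrite -[K f]/((S f - ((l%:C)%C *: P' f + ((1 - l)%:C)%C *: Q' f)) : V).
  by rewrite !scalerBr addrACA -opprD opprB addrA subrK.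
apply: le_trans (fnormB pb _ _) _.
have := comb (P f - P' f) (Q f - Q' f); rewrite hnormE.
have := PP' f; have := QQ' f; rewrite hnormE => hQ hP hc.
have := ler_wpM2l l0 hP; have := Kle f.
have := ler_wpM2l (_ : 0 <= 1 - l) hQ; rewrite subr_ge0 => /(_ l1).
move: hc; set u := fnorm _ _; set v := fnorm _ (K f).
by move=> h1 h2 h3 h4; apply: le_trans (lerD (le_trans h1 (lerD h4 h2)) h3) _; lra.
Qed.

End Convexity.

Theorem theorem4p2 (R : realType) (V : lmodType R[i]) (ip : V -> V -> R[i])
    (d : measure_display) (X : measurableType d)
    (mu : {measure set X -> \bar R}) (T : X -> V -> V) :
  separable_hilbert_space ip ->
  non_atomic mu ->
  bessel_family mu ip T ->
  op_convex ip (op_closure ip (Phi_range mu ip T)).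
Proof.
exact: op_closure_Phi_range_convex.
Qed.
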